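(* Let $n$ be a positive integer and let $$\psi(x)=\sum_{\pi\in\mathfrak{B}_n}\binom{x+n-\operatorname{ades}(\pi)}{n}\,\pi,\qquad \phi(x)=\sum_{\pi\in\mathfrak{B}_n}\binom{x+n-\operatorname{des}(\pi)}{n}\,\pi,$$ polynomials in $x$ with coefficients in the group algebra $\mathbb{Q}[\mathfrak{B}_n]$ of the hyperoctahedral group. Then, as polynomials in $x$ and $y$ with coefficients in $\mathbb{Q}[\mathfrak{B}_n]$, $$\psi(x)\phi(y)=\psi(2xy+x),$$ or, upon substituting $x\leftarrow x/2$ and $y\leftarrow (y-1)/2$, $$\psi(x/2)\,\phi((y-1)/2)=\psi(xy/2).$$
   Context: $\mathfrak{B}_n$ is the hyperoctahedral group: the group, under composition $(\sigma\tau)(s)=\sigma(\tau(s))$, of all bijections $\pi$ of $\{-n,\ldots,-1,0,1,\ldots,n\}$ with $\pi(-s)=-\pi(s)$ for $s=0,1,\ldots,n$ (so $\pi(0)=0$). For $\pi\in\mathfrak{B}_n$, the descent number $\operatorname{des}(\pi)$ is the number of $i\in\{0,1,\ldots,n-1\}$ with $\pi(i)>\pi(i+1)$. The augmented descent number $\operatorname{ades}(\pi)$ is the number of augmented descents of $\pi$, where $\pi$ has an augmented descent at position $i\in\{0,1,\ldots,n\}$ if $0\le i\le n-1$ and $\pi(i)>\pi(i+1)$, or if $i=n$ and $\pi(n)>0$. For a polynomial $p$, $\binom{p}{n}=\frac{p(p-1)\cdots(p-n+1)}{n!}$. The variables $x,y$ are commuting indeterminates that also commute with the elements of the group algebra.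 *)

(* Defs.v *)
(* MathComp *)
From HB Require Import structures.
From mathcomp Require Import all_boot all_order all_fingroup all_algebra.

Set Implicit Arguments.
Unset Strict Implicit.
Unset Printing Implicit Defensive.

Import Order.TTheory GRing.Theory Num.Theory.
Local Open Scope ring_scope.

(* The set {-n, ..., n} is encoded as 'I_(2n+1): the ordinal i stands for the *)
(* integer i - n, and rev_ord is negation (lemma sintN).                      *)
Definition sletter (n : nat) := 'I_(n.*2.+1).

Definition sint n (i : sletter n) : int := (i : nat)%:Z - n%:Z.

Definition sletter_of n (k : nat) : sletter n := inord (n + k).

Lemma sintN n (i : sletter n) : sint (rev_ord i) = - sint i.
Proof.
case: i => i lt_i; rewrite /sint /= subSS -(subzn (m := n.*2)) //.
by rewrite -addnn PoszD opprB addrAC addrK.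
Qed.

Lemma sint_inj n : injective (@sint n).
Proof. by move=> i j /addIr [] /val_inj. Qed.

Lemma sint_sletter_of n k : (k <= n)%N -> sint (sletter_of n k) = k%:Z.
Proof.
move=> le_kn; rewrite /sint inordK; last by rewrite -addnn ltnS leq_add2l.
by rewrite PoszD addrAC subrr add0r.
Qed.

Record hyperoct (n : nat) := Hyperoct {
  hperm : {perm sletter n};
  _ : [forall i, hperm (rev_ord i) == rev_ord (hperm i)]
}.

HB.instance Definition _ n := [isSub for @hperm n].
#[hnf] HB.instance Definition _ n := [Finite of hyperoct n by <:].

Section HyperoctGroup.
Variable n : nat.
Implicit Types s t : hyperoct n.

Definition hact s (i : sletter n) : sletter n := hperm s i.

Lemma hactN s i : hact s (rev_ord i) = rev_ord (hact s i).
Proof. by have /forallP/(_ i)/eqP := valP s. Qed.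

Fact hyperoct_one_subproof :
  [forall i, (1%g : {perm sletter n}) (rev_ord i)
             == rev_ord ((1%g : {perm sletter n}) i)].
Proof. by apply/forallP=> i; rewrite !perm1. Qed.
Definition hyperoct_one := Hyperoct hyperoct_one_subproof.

(* In {perm T} the product p * q applies p first; here (s * t)(i) = s (t i),  *)
(* see hactM.                                                                 *)
Fact hyperoct_mul_subproof s t :
  [forall i, (hperm t * hperm s)%g (rev_ord i)
             == rev_ord ((hperm t * hperm s)%g i)].
Proof.
by apply/forallP=> i; rewrite !permM -!/(hact _ _) !hactN.
Qed.
Definition hyperoct_mul s t := Hyperoct (hyperoct_mul_subproof s t).

Fact hyperoct_inv_subproof s :
  [forall i, (hperm s)^-1%g (rev_ord i) == rev_ord ((hperm s)^-1%g i)].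
Proof.
apply/forallP=> i; apply/eqP/(@perm_inj _ (hperm s)).
by rewrite permKV -!/(hact _ _) hactN /hact permKV.
Qed.
Definition hyperoct_inv s := Hyperoct (hyperoct_inv_subproof s).

Fact hyperoct_mulA : associative hyperoct_mul.
Proof. by move=> s t u; apply: val_inj; rewrite /= mulgA. Qed.

Fact hyperoct_mul1 : left_id hyperoct_one hyperoct_mul.
Proof. by move=> s; apply: val_inj; rewrite /= mulg1. Qed.

Fact hyperoct_mulV : left_inverse hyperoct_one hyperoct_inv hyperoct_mul.
Proof. by move=> s; apply: val_inj; rewrite /= mulgV. Qed.

HB.instance Definition _ := Finite_isGroup.Build (hyperoct n)
  hyperoct_mulA hyperoct_mul1 hyperoct_mulV.

Lemma hactM s t i : hact (s * t)%g i = hact s (hact t i).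
Proof. by rewrite /hact permM. Qed.

(* The integer s(k), meaningful for 0 <= k <= n. *)
Definition hval s (k : nat) : int := sint (hact s (sletter_of n k)).

Definition des s : nat := #|[set i : 'I_n | hval s i > hval s i.+1]|.

Definition ades s : nat :=
  #|[set i : 'I_n.+1 | ((i < n)%N && (hval s i > hval s i.+1))
                    || ((i == n :> nat) && (hval s n > 0))]|.

End HyperoctGroup.

(* {ffun gT -> R} already carries the pointwise product; the alias galg gets  *)
(* the convolution product instead, i.e. the group algebra R[gT].             *)
Definition galg (R : comNzRingType) (gT : finGroupType) := {ffun gT -> R}.

Section GroupAlgebra.
Variables (R : comNzRingType) (gT : finGroupType).

HB.instance Definition _ := GRing.Lmodule.copy (galg R gT) {ffun gT -> R^o}.

Implicit Types u v w : galg R gT.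

Definition gdelta (g : gT) : galg R gT := [ffun h => (h == g)%:R].

Definition galg_mul u v : galg R gT :=
  [ffun g => \sum_h u h * v (h^-1 * g)%g].

Fact galg_mulA : associative galg_mul.
Proof.
move=> u v w; apply/ffunP=> g; rewrite !ffunE.
under eq_bigr => h _ do rewrite ffunE mulr_sumr.
under [RHS]eq_bigr => k _ do rewrite ffunE mulr_suml.
rewrite [RHS]exchange_big; apply: eq_bigr => h _ /=.
rewrite [RHS](reindex_inj (mulgI h)) /=; apply: eq_bigr => k _.
by rewrite mulrA mulKg invMg mulgA.
Qed.

Fact galg_mul1l : left_id (gdelta 1%g) galg_mul.
Proof.
move=> u; apply/ffunP=> g; rewrite ffunE (bigD1 1%g) //= big1 => [|h /negPf].
  by rewrite ffunE eqxx mul1r addr0 invg1 mul1g.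
by rewrite ffunE => ->; rewrite mul0r.
Qed.

Fact galg_mul1r : right_id (gdelta 1%g) galg_mul.
Proof.
move=> u; apply/ffunP=> g; rewrite ffunE (bigD1 g) //= big1 => [|h ne_hg].
  by rewrite ffunE mulVg eqxx mulr1 addr0.
by rewrite ffunE -eq_invg_mul invgK (negPf ne_hg) mulr0.
Qed.

Fact galg_mulDl : left_distributive galg_mul +%R.
Proof.
move=> u v w; apply/ffunP=> g; rewrite !ffunE -big_split; apply: eq_bigr => h _.
by rewrite ffunE mulrDl.
Qed.

Fact galg_mulDr : right_distributive galg_mul +%R.
Proof.
move=> u v w; apply/ffunP=> g; rewrite !ffunE -big_split; apply: eq_bigr => h _.
by rewrite ffunE mulrDr.
Qed.

Fact galg_1_neq0 : gdelta 1%g != 0 :> galg R gT.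
Proof.
by apply/eqP=> /ffunP/(_ 1%g)/eqP; rewrite !ffunE eqxx oner_eq0.
Qed.

HB.instance Definition _ := GRing.Zmodule_isNzRing.Build (galg R gT)
  galg_mulA galg_mul1l galg_mul1r galg_mulDl galg_mulDr galg_1_neq0.

Fact galg_scaleAl (a : R) u v : a *: (u * v) = (a *: u) * v.
Proof.
apply/ffunP=> g; rewrite !ffunE scaler_sumr; apply: eq_bigr => h _.
by rewrite ffunE scalerAl.
Qed.

HB.instance Definition _ :=
  GRing.Lmodule_isLalgebra.Build R (galg R gT) galg_scaleAl.

Fact galg_scaleAr (a : R) u v : a *: (u * v) = u * (a *: v).
Proof.
apply/ffunP=> g; rewrite !ffunE scaler_sumr; apply: eq_bigr => h _.
by rewrite ffunE scalerAr.
Qed.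

HB.instance Definition _ :=
  GRing.Lalgebra_isAlgebra.Build R (galg R gT) galg_scaleAr.

Lemma gdeltaM g h : gdelta (g * h)%g = gdelta g * gdelta h.
Proof.
apply/ffunP=> k; rewrite !ffunE (bigD1 g) //= big1 => [|x /negPf].
  by rewrite !ffunE eqxx mul1r addr0 -[in RHS](inj_eq (mulgI g)) mulKVg.
by rewrite ffunE => ->; rewrite mul0r.
Qed.

End GroupAlgebra.

Definition binp (p : {poly rat}) (n : nat) : {poly rat} :=
  (n`!%:R)^-1 *: \prod_(i < n) (p - i%:R).

Notation "''QB_' n" := (galg rat (hyperoct n))
  (at level 8, n at level 2, format "''QB_' n").

Definition psi (n : nat) : {poly 'QB_n} :=
  \sum_(s : hyperoct n)
    map_poly (in_alg 'QB_n) (binp ('X + n%:R - (ades s)%:R) n)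
    * (gdelta rat s)%:P.

Definition phi (n : nat) : {poly 'QB_n} :=
  \sum_(s : hyperoct n)
    map_poly (in_alg 'QB_n) (binp ('X + n%:R - (des s)%:R) n)
    * (gdelta rat s)%:P.

(* p(q) as a polynomial in two variables over A, for p in A[x] and q a        *)
(* bivariate polynomial with rational (hence central) coefficients.           *)
Definition subst2 (A : algType rat) (p : {poly A}) (q : {poly {poly rat}}) :
    {poly {poly A}} :=
  (map_poly (polyC \o polyC) p).[map_poly (map_poly (in_alg A)) q].

(* Hence x / 2 in the statement is a genuine division in {poly {poly rat}}.   *)
Lemma unit2_poly2 : (2 : {poly {poly rat}}) \is a GRing.unit.
Proof.
have -> : (2 : {poly {poly rat}}) = (2 : rat)%:P%:P by rewrite !rmorph_nat.
by do 2!apply: (rmorph_unit polyC); rewrite unitfE.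
Qed.

(* Main.v *)
(* For natural x, phi(x) is the sum of sort(v) over the odd maps v from       *)
(* {-n..n} to {-x..x}, where sort(v) is the unique signed permutation s such  *)
(* that (v(s i), s i) is lexicographically increasing; psi(x) is the same sum *)
(* over the v that avoid the value x on positive letters. If s = sort(u) and  *)
(* t = sort(v), then s t sorts the lexicographically ordered pairs            *)
(* (v(s^-1 j), u(j)), and w = 2 x v(s^-1 j) + u(j) encodes these pairs by a   *)
(* vector counted by psi(2 x y + x); (u, v) |-> w is a bijection. A polynomial*)
(* identity valid at all positive integers holds identically.                 *)
Require Import Defs.
From HB Require Import structures.
From mathcomp Require Import all_boot all_order all_fingroup all_algebra.
From mathcomp Require Import zify ring.

Set Implicit Arguments.
Unset Strict Implicit.
Unset Printing Implicit Defensive.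

Import GRing.Theory Num.Theory.

(** Comparing coefficients of a group element [g] reduces the theorem to one numerical identity: the
    sum over [s] of the [ades] binomial of [s] at x times the [des] binomial of [s^-1 * g] at y
    equals the [ades] binomial of [g] at 2xy + x ([sum_binp_ades_des]).

    At positive integers each binomial counts the odd vectors sorted by a given permutation
    ([num_sorts_bin]). Read along s(0), ..., s(n), such a vector is a weakly increasing sequence
    that starts at 0, is strict at the descents of s and is bounded by x, or by x - 1 for psi when
    s(n) > 0. A shift turns these sequences into subsets of size [n].

    The identity between counts is a bijection given by Euclidean division by 2x ([num_sorts_mul]).
    [horner_mul_subst] passes from positive integers to indeterminates, and [subst2_psi_phi]
    reassembles the coefficients. *)

(** * Lexicographic sorting of odd vectors by signed permutations *)

Section Sorting.
Variables (n x : nat).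
Implicit Types (v : {ffun sletter n -> sletter x}) (s t : hyperoct n).

Definition lexlt v (i j : sletter n) : bool :=
  (v i < v j) || (v i == v j) && (i < j).

Definition odd_ffun v : bool := [forall i, v (rev_ord i) == rev_ord (v i)].

Definition sorts v s : bool :=
  [forall i : sletter n, forall j : sletter n,
     (i < j) ==> lexlt v (hact s i) (hact s j)].

Lemma val_rev_letter m (i : sletter m) : rev_ord i = m.*2 - i :> nat.
Proof. by rewrite /= subSS. Qed.

Lemma ltn_letter m (i : sletter m) : i <= m.*2.
Proof. by rewrite -ltnS. Qed.

Lemma sortsP v s :
  reflect (forall i j : sletter n, i < j -> lexlt v (hact s i) (hact s j))
          (sorts v s).
Proof.
apply: (iffP forallP) => [h i j ij|h i].
  by have /forallP/(_ j)/implyP := h i; apply.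
by apply/forallP=> j; apply/implyP/h.
Qed.

Lemma odd_ffunP v :
  reflect (forall i, v (rev_ord i) = rev_ord (v i)) (odd_ffun v).
Proof. by apply: (iffP forallP) => h i; apply/eqP/h. Qed.

Lemma lexltE v i j :
  lexlt v i j =
  ((v i : nat) < v j) || ((v i : nat) == v j) && ((i : nat) < j).
Proof. by []. Qed.

Lemma lexlt_irr v : irreflexive (lexlt v).
Proof. by move=> i; rewrite lexltE; lia. Qed.

Lemma lexlt_trans v : transitive (lexlt v).
Proof. by move=> j i k; rewrite !lexltE; lia. Qed.

Lemma lexlt_total v i j : i != j -> lexlt v i j || lexlt v j i.
Proof. by rewrite !lexltE -val_eqE /=; lia. Qed.

Lemma lexlt_rev v i j :
  odd_ffun v -> lexlt v (rev_ord i) (rev_ord j) = lexlt v j i.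
Proof.
move=> /odd_ffunP ov; rewrite !lexltE !ov !val_rev_letter.
have := ltn_letter i; have := ltn_letter j.
by have := ltn_letter (v i); have := ltn_letter (v j); lia.
Qed.

(** The position of [i] in the lexicographic order; the sorting permutation is the inverse of this
    map. *)
Definition lexrank v i := #|[set j | lexlt v j i]|.

Lemma lexrank_lt v i : lexrank v i < n.*2.+1.
Proof.
rewrite -[X in _ < X]card_ord -cardsT; apply: proper_card.
by apply/properP; split=> //; exists i; rewrite ?inE ?lexlt_irr.
Qed.

Lemma lexrank_mono v i j : lexlt v i j -> lexrank v i < lexrank v j.
Proof.
move=> ij; apply/proper_card/properP; split; last first.
  by exists i; rewrite inE ?lexlt_irr.
by apply/subsetP=> k; rewrite !inE => /lexlt_trans; apply.
Qed.

(** The letters lexicographically below [hact s i] are exactly the images under [s] of the letters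
    below [i]. *)
Lemma sorts_lexrank v s i : sorts v s -> lexrank v (hact s i) = i.
Proof.
move=> /sortsP sv; rewrite /lexrank.
have -> : [set j | lexlt v j (hact s i)]
          = hact s @: [set j : sletter n | j < i].
  apply/setP=> j; rewrite inE; apply/idP/imsetP => [ji|[k]]; last first.
    by rewrite inE => ki ->; apply: sv.
  exists (hact s^-1%g j); last by rewrite -hactM mulgV /hact perm1.
  rewrite inE ltnNge; apply/negP; rewrite leq_eqVlt => /orP[/eqP/val_inj ij|].
    by move: ji; rewrite ij -hactM mulgV /hact perm1 lexlt_irr.
  move=> /sv; rewrite -hactM mulgV [X in lexlt _ _ X]/hact perm1.
  by move=> /(lexlt_trans ji); rewrite lexlt_irr.
rewrite card_imset; last exact: perm_inj.
rewrite -sum1dep_card -(big_ord_widen _ (fun=> 1)) 1?ltnW //.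
by rewrite sum1_card card_ord.
Qed.

Lemma lexrank_inj v : injective (lexrank v).
Proof.
move=> i j eq_ij; apply/eqP; case: eqVneq => // /(lexlt_total v).
by case/orP=> /lexrank_mono; rewrite eq_ij ltnn.
Qed.

Lemma sorts_uniq v s t : sorts v s -> sorts v t -> s = t.
Proof.
move=> sv tv; apply/val_inj/permP=> i.
by apply: (@lexrank_inj v); rewrite !sorts_lexrank.
Qed.

(** Negation reverses the lexicographic order, so this rank counts the letters above [i]; those
    below and above [i] together are the [n.*2] other letters. *)
Lemma lexrank_rev v i :
  odd_ffun v -> lexrank v (rev_ord i) = n.*2 - lexrank v i.
Proof.
move=> ov; have <- : #|[set j | lexlt v i j]| = lexrank v (rev_ord i).
  rewrite /lexrank -[RHS](card_preimset _ (@rev_ord_inj _)).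
  by apply: eq_card => j; rewrite !inE lexlt_rev.
suff : #|[set j | lexlt v i j]| + lexrank v i = n.*2
  by move=> e; rewrite -[LHS](addnK (lexrank v i)) e.
rewrite /lexrank; set A := [set j | _]; set B := [set j | _].
have dAB : [disjoint A & B].
  apply/pred0P=> j /=; rewrite !inE; apply/negP=> /andP[ij].
  by move=> /(lexlt_trans ij); rewrite lexlt_irr.
have [_] := leq_card_setU A B; rewrite dAB => /eqP <-.
have -> : A :|: B = [set~ i].
  apply/setP=> j; rewrite !inE; case: eqVneq => [->|ne].
    by rewrite !lexlt_irr.
  by rewrite orbC lexlt_total.
by rewrite cardsC1 card_ord.
Qed.

(** The witness is the inverse of the rank permutation, which commutes with negation by
    [lexrank_rev]. *)
Lemma sorts_exists v : odd_ffun v -> exists s, sorts v s.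
Proof.
move=> ov; pose r i := Ordinal (lexrank_lt v i).
have r_inj : injective r by move=> i j [] /lexrank_inj.
have rN i : perm r_inj (rev_ord i) = rev_ord (perm r_inj i).
  by apply: ord_inj; rewrite !permE val_rev_letter /= lexrank_rev.
have sN : [forall i, (perm r_inj)^-1%g (rev_ord i)
                     == rev_ord ((perm r_inj)^-1%g i)].
  apply/forallP=> i; apply/eqP/(@perm_inj _ (perm r_inj)).
  by rewrite rN !permKV.
exists (Hyperoct sN); apply/sortsP=> i j; rewrite /hact /=.
rewrite -{1}[i](permKV (perm r_inj)) -{1}[j](permKV (perm r_inj)).
set i' := (_ i); set j' := (_ j); rewrite !permE /= => lt_ij.
have /(lexlt_total v)/orP[//|/lexrank_mono] : i' != j'.
  by apply: contraTneq lt_ij => ->; rewrite ltnn.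
by rewrite ltnNge ltnW.
Qed.

End Sorting.

Lemma sorts_lexlt n x (v : {ffun sletter n -> sletter x}) s i j :
  sorts v s -> lexlt v (hact s i) (hact s j) = ((i : nat) < j).
Proof.
move=> /sortsP sv; case: ltngtP => [/sv //|/sv ji|/val_inj ->].
  by apply/negP=> /(lexlt_trans ji); rewrite lexlt_irr.
by rewrite lexlt_irr.
Qed.

Lemma hactK n (s : hyperoct n) : cancel (hact s) (hact s^-1%g).
Proof. by move=> i; rewrite -hactM mulVg /hact perm1. Qed.

Lemma hactKV n (s : hyperoct n) : cancel (hact s^-1%g) (hact s).
Proof. by move=> i; rewrite -hactM mulgV /hact perm1. Qed.

Lemma vector_ext n x (v w : {ffun sletter n -> sletter x}) :
  (forall i, v i = w i :> nat) -> v = w.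
Proof. by move=> e; apply/ffunP=> i; apply: ord_inj. Qed.

(* Values are stored with offset [x], so [v j < x.*2] says that the integer   *)
(* value at the positive letter [j] is not [x].                               *)
Definition odd_vectors (c : bool) n x : {set {ffun sletter n -> sletter x}} :=
  [set v | odd_ffun v &&
           (c ==> [forall j : sletter n, (n < j) ==> (v j < x.*2)])].

(** For positive [x] this is the coefficient of [s] in psi(x) when [c] is true, and in phi(x) when
    [c] is false. *)
Definition num_sorts c n x (s : hyperoct n) : nat :=
  #|[set v in odd_vectors c n x | sorts v s]|.

Lemma odd_vectorsP (c : bool) n x (v : {ffun sletter n -> sletter x}) :
  reflect ((forall i, v (rev_ord i) = x.*2 - v i :> nat) /\
           (c -> forall j : sletter n, n < j -> v j < x.*2))
          (v \in odd_vectors c n x).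
Proof.
rewrite inE; apply: (iffP andP) => [[ov /implyP vc]|[ov vc]]; split.
- by move=> i; rewrite (odd_ffunP _ ov) val_rev_letter.
- by move=> /vc /forallP h j nj; have /implyP := h j; apply.
- by apply/odd_ffunP=> i; apply: ord_inj; rewrite val_rev_letter -ov.
- by apply/implyP=> /vc h; apply/forallP=> j; apply/implyP/h.
Qed.

(** * The bijection behind the product formula *)

Section Product.
Variables (n x y : nat).
Hypothesis x_gt0 : 0 < x.

Let m := (x * y).*2 + x.

Implicit Types (u : {ffun sletter n -> sletter x})
  (a v : {ffun sletter n -> sletter y}) (w : {ffun sletter n -> sletter m}).

(** Oddness forces the value 0, stored as [x], at the central letter, and turns the strict upper
    bound on positive letters into a strict lower bound on negative ones. *)
Lemma odd_vectors_bounds u (j : sletter n) : u \in odd_vectors true n x ->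
  [/\ j = n :> nat -> u j = x :> nat, n < j -> u j < x.*2
    & j < n -> 0 < u j].
Proof.
move=> /odd_vectorsP[ou /(_ isT) uc]; have leN := ltn_letter (rev_ord j).
have lej := ltn_letter j; have leu := ltn_letter (u j).
have := ou j; have := uc j; have := uc (rev_ord j).
rewrite val_rev_letter => h1 h2 e.
split=> hj; [|exact: h2|]; last by move: h1; rewrite e; lia.
have ej : rev_ord j = j by apply: ord_inj; rewrite val_rev_letter; lia.
by move: e; rewrite ej; lia.
Qed.

(* On positive letters, [w = 2x * a + u] is a Euclidean division; the only    *)
(* ties between different quotients are [(a, 2x)] and [(a + 1, 0)], and there *)
(* the first letter is negative and the second positive.                      *)
Lemma lexlt_interleave u a w (i j : sletter n) :
    u \in odd_vectors true n x ->
    (forall k, w k = x.*2 * a k + u k :> nat) ->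
  lexlt w i j = (a i < a j) || (a i == a j :> nat) && lexlt u i j.
Proof.
move=> uV ew; rewrite !lexltE !ew.
have [i1 i2 i3] := odd_vectors_bounds i uV.
have [j1 j2 j3] := odd_vectors_bounds j uV.
have := ltn_letter (u i); have := ltn_letter (u j).
case: (ltngtP (a i) (a j)) => [lt|lt|->]; last by lia.
- by have := leq_mul (leqnn x.*2) lt; rewrite mulnS; lia.
- by have := leq_mul (leqnn x.*2) lt; rewrite mulnS; lia.
Qed.

(** The stored offsets combine correctly, since [x.*2 * y + x = m]: the same formula holds for the
    signed values. *)
Definition interleave (p : hyperoct n * ({ffun sletter n -> sletter x} *
                                   {ffun sletter n -> sletter y})) :
    {ffun sletter n -> sletter m} :=
  [ffun j => inord (x.*2 * p.2.2 (hact p.1^-1%g j) + p.2.1 j)].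

Lemma interleaveE p (j : sletter n) :
  interleave p j = x.*2 * p.2.2 (hact p.1^-1%g j) + p.2.1 j :> nat.
Proof.
rewrite ffunE inordK //; set a := p.2.2 _; set b := p.2.1 j.
have := ltn_letter a; have := ltn_letter b => hb /(leq_mul (leqnn x.*2)).
by rewrite /m; lia.
Qed.

Variable t : hyperoct n.

Definition sorted_pairs :=
  [set p : hyperoct n * ({ffun sletter n -> sletter x} *
                                   {ffun sletter n -> sletter y}) |
     (p.2.1 \in [set v in odd_vectors true n x | sorts v p.1]) &&
     (p.2.2 \in [set v in odd_vectors false n y | sorts v (p.1^-1 * t)%g])].

Lemma card_sorted_pairs :
  #|sorted_pairs| =
  \sum_s num_sorts true x s * num_sorts false y (s^-1 * t)%g.
Proof.
rewrite -sum1_card /= (eq_bigr (fun s : hyperoct n =>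
  \sum_(q | (q.1 \in [set v in odd_vectors true n x | sorts v s]) &&
     (q.2 \in [set v in odd_vectors false n y | sorts v (s^-1 * t)%g])) 1)).
  by rewrite pair_big_dep /=; apply: eq_bigl => p; rewrite !inE.
move=> s _; rewrite -cardsX -sum1_card; apply: eq_bigl => q.
by case: q => a b; rewrite in_setX.
Qed.

(** On nonnegative letters [u j < x.*2], so reduction modulo [x.*2] recovers [u] there, and oddness
    recovers it elsewhere. Then [u] determines [s], and the quotients determine [v]. *)
Lemma interleave_inj : {in sorted_pairs &, injective interleave}.
Proof.
move=> [s [u v]] [s' [u' v']]; change {ffun sletter n -> sletter x} in u, u'.
change {ffun sletter n -> sletter y} in v, v'.
rewrite ![_ \in sorted_pairs]inE /= ![_ \in [set _ in _ | _]]inE.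
move=> /andP[/andP[uV us] /andP[vV vs]].
move=> /andP[/andP[uV' us'] /andP[vV' vs']] eqw.
have ew j : x.*2 * v (hact s^-1%g j) + u j =
            x.*2 * v' (hact s'^-1%g j) + u' j.
  by rewrite -(interleaveE (s, (u, v))) -(interleaveE (s', (u', v'))) eqw.
have eu : u = u'.
  have pos (j : sletter n) : n <= j -> u j = u' j :> nat.
    have [j1 j2 j3] := odd_vectors_bounds j uV.
    have [k1 k2 k3] := odd_vectors_bounds j uV'.
    move=> nj.
    have uj : u j < x.*2 by lia.
    have uj' : u' j < x.*2 by lia.
    have := congr1 (modn^~ x.*2) (ew j).
    by rewrite /= ![x.*2 * _]mulnC !modnMDl !modn_small.
  apply: vector_ext => j; case: (leqP n j) => [/pos //|jn].
  have /odd_vectorsP[ou _] := uV; have /odd_vectorsP[ou' _] := uV'.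
  have nj : n <= rev_ord j by rewrite val_rev_letter; lia.
  have := pos _ nj; rewrite ou ou'.
  have := ltn_letter (u j); have := ltn_letter (u' j); lia.
subst u'; have es := sorts_uniq us us'; subst s'.
congr (_, (_, _)); apply: vector_ext => k.
have /eqP := ew (hact s k); rewrite !hactK eqn_add2r eqn_pmul2l ?double_gt0 //.
by move/eqP.
Qed.

(** Write [t k] as [s] applied to [(s^-1 * t) k]. As [s] sorts [u], comparing two images under [s]
    in the order of [u] is comparing the letters themselves, so the order of [w] along [t] is that
    of [v] along [s^-1 * t]. *)
Lemma interleave_sorts p : p \in sorted_pairs ->
  (interleave p \in odd_vectors true n m) && sorts (interleave p) t.
Proof.
case: p => [s [u v]]; change {ffun sletter n -> sletter x} in u.
change {ffun sletter n -> sletter y} in v; rewrite ![_ \in sorted_pairs]inE /=.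
rewrite ![_ \in [set _ in _ | _]]inE => /andP[/andP[uV us] /andP[vV vs]].
pose a := [ffun j => v (hact s^-1%g j)].
have ew k : interleave (s, (u, v)) k = x.*2 * a k + u k :> nat.
  by rewrite interleaveE /= /a ffunE.
have /odd_vectorsP[ou _] := uV; have /odd_vectorsP[ov _] := vV.
have oa j : a (rev_ord j) = y.*2 - a j :> nat by rewrite !ffunE hactN ov.
apply/andP; split.
  apply/odd_vectorsP; split=> [i|_ j nj].
    rewrite !ew oa ou mulnBr; have := leq_mul (leqnn x.*2) (ltn_letter (a i)).
    by have := ltn_letter (u i); rewrite /m; lia.
  have [_ /(_ nj) uj _] := odd_vectors_bounds j uV; rewrite ew.
  by have := leq_mul (leqnn x.*2) (ltn_letter (a j)); rewrite /m; lia.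
apply/sortsP=> i j ij; rewrite (lexlt_interleave _ _ uV ew) !ffunE -!hactM.
have e k : hact t k = hact s (hact (s^-1 * t)%g k) by rewrite -hactM mulKVg.
rewrite !e (sorts_lexlt _ _ us); have /sortsP/(_ _ _ ij) := vs.
by rewrite lexltE.
Qed.

(** Quotient and remainder by [x.*2] are taken on nonnegative letters only and extended by oddness;
    dividing directly on negative letters need not give odd vectors. *)
Lemma interleave_surj w : w \in odd_vectors true n m -> sorts w t ->
  exists2 p, p \in sorted_pairs & w = interleave p.
Proof.
move=> /odd_vectorsP[ow /(_ isT) wc] wt.
pose A (j : sletter n) := if n <= (j : nat) then w j %/ x.*2
                          else y.*2 - w (rev_ord j) %/ x.*2.
pose B (j : sletter n) := if n <= (j : nat) then w j %% x.*2
                          else x.*2 - w (rev_ord j) %% x.*2.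
have Ap (j : sletter n) : n <= j -> A j = w j %/ x.*2 by rewrite /A => ->.
have An (j : sletter n) : j < n -> A j = y.*2 - w (rev_ord j) %/ x.*2.
  by rewrite /A ltnNge => /negPf ->.
have x2 : 0 < x.*2 by rewrite double_gt0.
have wn (j : sletter n) : j = n :> nat -> w j = m :> nat.
  move=> jn; have rj : rev_ord j = j.
    by apply: ord_inj; rewrite val_rev_letter; lia.
  by have := ow j; rewrite rj; have := ltn_letter (w j); lia.
(* The bound is [m.*2]; avoiding the top value on positive letters is what keeps the quotient at
   most [y.*2]. *)
have wlt (j : sletter n) : n <= j -> w j < x.*2 * y.*2.+1.
  rewrite leq_eqVlt => /orP[/eqP/esym/wn ->|/wc]; rewrite /m; lia.
have dlt j : w j %% x.*2 < x.*2 by rewrite ltn_mod.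
have qlt (j : sletter n) : n <= j -> w j %/ x.*2 <= y.*2.
  by move=> nj; rewrite -ltnS ltn_divLR // mulnC; exact: wlt.
have rN (j : sletter n) : j < n -> n < rev_ord j.
  by rewrite val_rev_letter; lia.
have Ale j : A j <= y.*2.
  by rewrite /A; case: (leqP n j) => h; [exact: qlt | exact: leq_subr].
have Ble j : B j <= x.*2.
  by rewrite /B; case: (leqP n j) => _; [exact: ltnW | exact: leq_subr].
have wE j : w j = x.*2 * A j + B j :> nat.
  rewrite /A /B; case: (leqP n j) => [_|jn]; first by rewrite mulnC -divn_eq.
  have := ow (rev_ord j); rewrite rev_ordK => ->.
  have := divn_eq (w (rev_ord j)) x.*2; have := dlt (rev_ord j).
  rewrite mulnBr [_ %/ _ * _]mulnC.
  have := leq_mul (leqnn x.*2) (qlt _ (ltnW (rN _ jn))).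
  by rewrite /m; lia.
have AN j : A (rev_ord j) = y.*2 - A j.
  have nm (k : sletter n) : k = n :> nat -> A k = y.
    move=> kn; rewrite Ap ?kn // wn // /m -mul2n mulnA mul2n mulnC divnMDl //.
    by rewrite divn_small ?addn0 //; lia.
  case: (ltngtP j n) => jn.
  - have nr := ltnW (rN _ jn); rewrite (Ap _ nr) (An _ jn) subKn //; exact: qlt.
  - have rj : rev_ord j < n.
      by rewrite val_rev_letter; have := ltn_letter j; lia.
    by rewrite (An _ rj) rev_ordK (Ap _ (ltnW jn)).
  - have rj : rev_ord j = n :> nat by rewrite val_rev_letter; lia.
    by rewrite !nm //; lia.
have BN j : B (rev_ord j) = x.*2 - B j.
  have := ow j; rewrite !wE AN mulnBr; have := Ble j; have := Ble (rev_ord j).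
  have := leq_mul (leqnn x.*2) (Ale j); rewrite /m; lia.
pose u : {ffun sletter n -> sletter x} := [ffun j => inord (B j)].
pose a : {ffun sletter n -> sletter y} := [ffun j => inord (A j)].
have uE j : u j = B j :> nat by rewrite ffunE inordK ?ltnS ?Ble.
have aE j : a j = A j :> nat by rewrite ffunE inordK ?ltnS ?Ale.
have uV : u \in odd_vectors true n x.
  apply/odd_vectorsP; split=> [i|_ j nj]; first by rewrite !uE BN.
  by rewrite uE /B (ltnW nj) dlt.
have [s us] : exists s, sorts u s.
  by apply: sorts_exists; move: uV; rewrite inE => /andP[].
(* Composing with [s] undoes the [s^-1] in [interleave]. *)
pose v : {ffun sletter n -> sletter y} := [ffun k => a (hact s k)].
exists (s, (u, v)); last first.
  by apply: vector_ext => j; rewrite interleaveE /= ffunE hactKV uE aE wE.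
have vE k : v k = A (hact s k) :> nat by rewrite ffunE aE.
have vV : v \in odd_vectors false n y.
  by apply/odd_vectorsP; split=> // i; rewrite !vE hactN AN.
rewrite inE /= 2![_ \in [set _ in _ | _]]inE uV vV us /=.
apply/sortsP=> i j ij; have /sortsP/(_ _ _ ij) := wt.
rewrite (@lexlt_interleave u a) => [||k]; rewrite ?uE ?aE ?wE //.
have e k : hact t k = hact s (hact (s^-1 * t)%g k) by rewrite -hactM mulKVg.
by rewrite !e (sorts_lexlt _ _ us) lexltE !vE.
Qed.

Lemma num_sorts_mul :
  \sum_s num_sorts true x s * num_sorts false y (s^-1 * t)%g =
  num_sorts true m t.
Proof.
rewrite -card_sorted_pairs -(card_in_imset interleave_inj); apply: eq_card => w.
rewrite inE; apply/imsetP/idP => [[p /interleave_sorts h ->] //|/andP[wV wt]].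
by have [p] := interleave_surj wV wt; exists p.
Qed.

End Product.

(** * Vectors with a given sorting permutation, counted by a binomial coefficient *)

Section Counting.
Variables (c : bool) (n x : nat) (s : hyperoct n).
Hypothesis x_gt0 : 0 < x.

Implicit Type v : {ffun sletter n -> sletter x}.

Let p k : sletter n := hact s (sletter_of n k).
Let d k : nat := p k.+1 < p k.
Let D k := \sum_(i < k) d i.
(** The augmented descent at position [n], recorded only in the psi case. *)
Let e : nat := c && (n < p n).

Lemma val_sletter_of m k : k <= m -> sletter_of m k = m + k :> nat.
Proof. by move=> km; rewrite inordK // ltnS -addnn leq_add2l. Qed.

Let p_neq k : k < n -> (p k : nat) != p k.+1.
Proof.
move=> kn; rewrite (inj_eq (@ord_inj _)) (can_eq (hactK s)).
rewrite -(inj_eq (@ord_inj _)).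
by rewrite !val_sletter_of ?(ltnW kn) //; lia.
Qed.

Let lexlt_step v k :
  k < n -> lexlt v (p k) (p k.+1) = (v (p k) + d k <= v (p k.+1)).
Proof. by move=> /p_neq; rewrite lexltE /d; lia. Qed.

(** By transitivity adjacent comparisons suffice, and oddness reflects those at nonnegative
    positions onto the negative ones. *)
Lemma sorts_stepsP v : odd_ffun v ->
  reflect (forall k, k < n -> v (p k) + d k <= v (p k.+1)) (sorts v s).
Proof.
move=> ov; apply: (iffP idP) => [sv k kn|steps].
  by rewrite -lexlt_step // sorts_lexlt // !val_sletter_of ?(ltnW kn) //; lia.
pose f i := hact s (inord i : sletter n).
have fE k : k <= n -> f (n + k) = p k by [].
have succ i : i.+1 < n.*2.+1 -> lexlt v (f i) (f i.+1).
  move=> i_lt; case: (leqP n i) => [ni|lt_in].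
    by rewrite -(subnKC ni) -addnS !fE ?lexlt_step ?steps //; lia.
  have fN j : j <= n -> f j = rev_ord (p (n - j)).
    move=> jn; rewrite /f /p -hactN; congr (hact s _); apply: ord_inj.
    by rewrite val_rev_letter val_sletter_of ?inordK //; lia.
  rewrite !fN ?lexlt_rev //; last exact: ltnW.
  have -> : n - i = (n - i.+1).+1 by lia.
  by rewrite lexlt_step ?steps //; lia.
apply/sortsP=> i j lt_ij.
have := @homo_ltn_in _ [pred i | i < n.*2.+1] f (lexlt v).
move=> /(_ (@lexlt_trans _ _ v)) h; have := h _ _ i j.
rewrite /f !inord_val; apply=> //; rewrite ?inE //.
- move=> i' k /= _; rewrite inE => kN l /andP[_].
  by rewrite inE => /ltn_trans; apply.
- by move=> k _; rewrite inE => /succ.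
Qed.

Let p0 v : odd_ffun v -> v (p 0) = x :> nat.
Proof.
move=> /odd_ffunP ov; have pN : rev_ord (p 0) = p 0.
  rewrite -hactN; congr (hact s _); apply: ord_inj.
  by rewrite val_rev_letter val_sletter_of //; lia.
have := congr1 (@nat_of_ord _) (ov (p 0)); rewrite pN val_rev_letter.
by have := ltn_letter (v (p 0)); lia.
Qed.

Let DS k : D k.+1 = D k + d k.
Proof. by rewrite /D big_ord_recr. Qed.

Lemma sorts_odd_vectorsP v : odd_ffun v ->
  reflect ((forall k, k < n -> v (p k) + d k <= v (p k.+1))
           /\ v (p n) + e <= x.*2)
    ((v \in odd_vectors c n x) && sorts v s).
Proof.
move=> ov; apply: (iffP andP) => [[/odd_vectorsP[_ vc] /(sorts_stepsP ov) st]|].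
  split=> //; rewrite /e; case: c vc => [/(_ isT (p n))|_] /=; last first.
    by rewrite addn0 ltn_letter.
  by case: (n < p n) => [/(_ isT)|_]; rewrite ?addn1 ?addn0 ?ltn_letter.
move=> [/(sorts_stepsP ov) sv le_e]; split=> //.
apply/odd_vectorsP; split=> [i|c1 j nj].
  by rewrite (odd_ffunP _ ov) val_rev_letter.
rewrite ltn_neqAle ltn_letter andbT; apply/negP=> /eqP vj.
(* [p n] is the lexicographically largest letter: if the positive letter [j] has the top value, so
   does [p n], which is then positive too, forcing [e = 1]. *)
have [jn vpn] : j <= p n /\ v (p n) = x.*2 :> nat.
  case: (ltngtP (hact s^-1%g j) (sletter_of n n)) => [lt| |/ord_inj h].
  - have := sorts_lexlt (hact s^-1%g j) (sletter_of n n) sv.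
    rewrite lt hactKV lexltE vj -/(p n).
    by have := ltn_letter (v (p n)); split; lia.
  - by rewrite val_sletter_of // addnn ltnNge ltn_letter.
  - by rewrite /p -h hactKV.
by move: le_e; rewrite vpn /e c1 (leq_trans nj jn) addn1 ltnn.
Qed.

Let M := x + n - (D n + e).

Let tup_val (t : n.-tuple 'I_M) k := nth 0 [seq \val i | i <- t] k.

(* [tup_val t k = alpha t k.+1 + k - D k.+1] turns a sequence with prescribed *)
(* strict steps into a strictly increasing one.                               *)
Let alpha (t : n.-tuple 'I_M) k :=
  if k is k'.+1 then tup_val t k' + D k - k' else 0.

(** The odd vector whose signed value at [p k] is [alpha t k]. *)
Let decode (t : n.-tuple 'I_M) : {ffun sletter n -> sletter x} :=
  [ffun j => let i := hact s^-1%g j in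
     inord (if n <= (i : nat) then x + alpha t (i - n)
            else x - alpha t (n - i))].

Section Decode.
Variable t : n.-tuple 'I_M.
Hypothesis t_sorted : sorted ltn [seq \val i | i <- t].

Let tup_lt k : k < n -> tup_val t k < M.
Proof.
move=> kn; set z := tnth t (Ordinal kn); have -> : tup_val t k = z.
  by rewrite /z (tnth_nth z) /tup_val (nth_map z) ?size_tuple.
exact: ltn_ord.
Qed.

Let tup_step k : k.+1 < n -> tup_val t k < tup_val t k.+1.
Proof.
move=> kn; have /sortedP := t_sorted => /(_ 0 k).
by rewrite size_map size_tuple; apply.
Qed.

(** This makes the truncated subtraction in [alpha] exact. *)
Let tup_ge k : k < n -> k <= tup_val t k.
Proof.
elim: k => // k IHk kn; exact: leq_ltn_trans (IHk (ltnW kn)) (tup_step kn).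
Qed.

Let alpha_step k : k < n -> alpha t k + d k <= alpha t k.+1.
Proof.
case: k => [|k] kn; rewrite /alpha; first by rewrite DS; lia.
rewrite [D k.+2]DS.
by have := tup_step kn; have := tup_ge kn; have := tup_ge (ltnW kn); lia.
Qed.

Let alpha_last : alpha t n + e <= x.
Proof.
have a0 k : k = 0 -> alpha t k = 0 by move=> ->.
have aS k : 0 < k -> alpha t k = tup_val t k.-1 + D k - k.-1 by case: k.
have [/a0 ->|n_gt0] := posnP n; first exact: leq_trans (leq_b1 _) x_gt0.
have := @tup_lt n.-1; have := @tup_ge n.-1; rewrite (aS n n_gt0) /M.
by lia.
Qed.

Let alpha_mono k j : k + j <= n -> alpha t k <= alpha t (k + j).
Proof.
elim: j => [|j IHj]; rewrite ?addn0 // addnS => kn.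
by have := IHj (ltnW kn); have := alpha_step kn; lia.
Qed.

Let alpha_le k : k <= n -> alpha t k <= x.
Proof.
move=> kn; have := alpha_last; have := @alpha_mono k (n - k).
by rewrite subnKC // leqnn => /(_ isT); lia.
Qed.

Let decodeE j :
  decode t j = (if n <= hact s^-1%g j then x + alpha t (hact s^-1%g j - n)
                else x - alpha t (n - hact s^-1%g j)) :> nat.
Proof.
rewrite ffunE /= inordK // ltnS; have := ltn_letter (hact s^-1%g j).
case: (leqP n (hact s^-1%g j)) => h hj; last by lia.
by have := @alpha_le (hact s^-1%g j - n); lia.
Qed.

Lemma decode_p k : k <= n -> decode t (p k) = x + alpha t k :> nat.
Proof.
by move=> kn; rewrite decodeE /p hactK val_sletter_of // leq_addr addKn.
Qed.

Lemma decode_odd : odd_ffun (decode t).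
Proof.
apply/odd_ffunP=> j; apply: ord_inj.
rewrite val_rev_letter !decodeE hactN val_rev_letter.
have := ltn_letter (hact s^-1%g j); set i := hact _ _ => hi.
case: (ltngtP n i) => ni.
- have -> : (n <= n.*2 - i) = false by lia.
  have -> : n - (n.*2 - i) = i - n by lia.
  by have := @alpha_le (i - n); lia.
- have -> : (n <= n.*2 - i) = true by lia.
  have -> : n.*2 - i - n = n - i by lia.
  by have := @alpha_le (n - i); lia.
- have -> : (n <= n.*2 - i) = true by lia.
  have -> : n.*2 - i - n = 0 by lia.
  have -> : i - n = 0 by lia.
  by rewrite /= addn0; lia.
Qed.

Lemma decode_sorts :
  (decode t \in odd_vectors c n x) && sorts (decode t) s.
Proof.
apply/(sorts_odd_vectorsP decode_odd); split=> [k kn|]; rewrite !decode_p //.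
- by rewrite -addnA leq_add2l alpha_step.
- exact: ltnW.
by have := alpha_last; lia.
Qed.

Lemma tup_valE k : k < n -> tup_val t k = decode t (p k.+1) - x + k - D k.+1.
Proof.
by move=> kn; rewrite decode_p // addKn /alpha; have := tup_ge kn; lia.
Qed.

End Decode.

Lemma decode_inj :
  {in [set t : n.-tuple 'I_M | sorted ltn [seq \val i | i <- t]] &,
    injective decode}.
Proof.
move=> t t'; rewrite !inE => st st' e_tt'.
apply/val_inj/(inj_map val_inj)/(@eq_from_nth _ 0).
  by rewrite !size_map !size_tuple.
rewrite size_map size_tuple => k kn.
have := tup_valE st kn; have := tup_valE st' kn.
by rewrite /tup_val e_tt' => -> ->.
Qed.

Lemma decode_surj v : (v \in odd_vectors c n x) && sorts v s ->
  exists2 t : n.-tuple 'I_M,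
    sorted ltn [seq \val i | i <- t] & v = decode t.
Proof.
move=> vs; have /andP[/odd_vectorsP[ov _] _] := vs.
have o : odd_ffun v.
  by apply/odd_ffunP=> i; apply: ord_inj; rewrite val_rev_letter ov.
have [step last_le] := sorts_odd_vectorsP o vs.
(* The inverse of [alpha] involves truncated subtractions; this bound makes them exact. *)
have ge_D k : k <= n -> x + D k <= v (p k).
  elim: k => [|k IHk] kn; first by rewrite p0 // /D big_ord0 addn0.
  by have := IHk (ltnW kn); have := step k kn; rewrite DS; lia.
(* Taken up to position [n], where [v (p n) + e <= x.*2], this puts the tuple entries below [M]. *)
have gap k j : k + j <= n -> v (p k) + D (k + j) <= v (p (k + j)) + D k.
  elim: j => [|j IHj]; rewrite ?addn0 // addnS => kn; rewrite DS.
  by have := IHj (ltnW kn); have := step _ kn; lia.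
have bound k : k < n -> v (p k.+1) - x + k - D k.+1 < M.
  move=> kn; have := @gap k.+1 (n - k.+1); rewrite subnKC // => /(_ (leqnn _)).
  by have := ge_D _ kn; rewrite /M; lia.
pose t := [tuple Ordinal (bound i (ltn_ord i)) | i < n].
have tE k : k < n -> tup_val t k = v (p k.+1) - x + k - D k.+1.
  move=> kn; rewrite /tup_val (nth_map (tnth t (Ordinal kn))) ?size_tuple //.
  by rewrite -[k in LHS]/(val (Ordinal kn)) -tnth_nth tnth_mktuple.
have st : sorted ltn [seq \val i | i <- t].
  apply/(sortedP 0)=> k; rewrite size_map size_tuple => kn.
  rewrite -!/(tup_val t _) !tE ?(ltnW kn) //.
  have := ge_D _ kn; have := ge_D _ (ltnW kn); have := step _ kn.
  by rewrite !DS; lia.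
exists t => //; have od := decode_odd st.
have eqp k : k <= n -> v (p k) = decode t (p k) :> nat.
  move=> kn; rewrite decode_p //; case: k kn => [|k] kn.
    by rewrite p0 // addn0.
  by rewrite /alpha tE //; have := ge_D _ kn; lia.
apply: vector_ext => j.
have pos (i : sletter n) : n <= i -> v (hact s i) = decode t (hact s i) :> nat.
  move=> ni; have := @eqp (i - n); rewrite /p /sletter_of subnKC // inord_val.
  by apply; have := ltn_letter i; lia.
rewrite -[j](hactKV s); set i := hact _ j.
case: (leqP n i) => [/pos //|lt_in].
have := pos (rev_ord i); rewrite hactN val_rev_letter.
rewrite (odd_ffunP _ o) (odd_ffunP _ od) !val_rev_letter.
have := ltn_letter (v (hact s i)); have := ltn_letter (decode t (hact s i)).
move=> h1 h2 h3; have /h3 : n <= n.*2 - i by lia.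
by lia.
Qed.

Lemma num_sorts_bin : num_sorts c x s = 'C(M, n).
Proof.
rewrite -card_ltn_sorted_tuples -(card_in_imset decode_inj).
apply: eq_card => v; rewrite inE.
apply/idP/imsetP => [/decode_surj[t st ->]|[t + ->]].
  by exists t; rewrite ?inE.
by rewrite inE => /decode_sorts.
Qed.

End Counting.

(** * Descent numbers and the counts *)

Lemma num_sorts_des n x (s : hyperoct n) :
  0 < x -> num_sorts false x s = 'C(x + n - des s, n).
Proof.
move=> x0; rewrite num_sorts_bin // addn0 /des -sum1dep_card.
congr 'C(_ - _, _); rewrite [RHS]big_mkcond /=; apply: eq_bigr => i _.
by rewrite /hval /sint ltrD2r ltz_nat; case: (_ < _).
Qed.

Lemma num_sorts_ades n x (s : hyperoct n) :
  0 < x -> num_sorts true x s = 'C(x + n - ades s, n).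
Proof.
move=> x0; rewrite num_sorts_bin // /ades -sum1dep_card.
congr 'C(_ - _, _); rewrite [RHS]big_mkcond /= big_ord_recr /= ltnn eqxx /=.
congr (_ + _); last first.
  by rewrite /hval /sint subr_gt0 ltz_nat; case: (_ < _).
apply: eq_bigr => i _; rewrite ltn_ord (ltn_eqF (ltn_ord i)) /= orbF.
by rewrite /hval /sint ltrD2r ltz_nat; case: (_ < _).
Qed.

Lemma des_le n (s : hyperoct n) : des s <= n.
Proof. by rewrite /des -[leqRHS]card_ord max_card. Qed.

Lemma ades_le n (s : hyperoct n) : ades s <= n.+1.
Proof. by rewrite /ades -[leqRHS]card_ord max_card. Qed.

(** * From positive integers to polynomial identities *)

Local Open Scope ring_scope.

Lemma prod_natrB_ffact (R : pzRingType) (k n : nat) :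
  \prod_(i < n) (k%:R - i%:R) = (k ^_ n)%:R :> R.
Proof.
elim: n => [|n IHn]; first by rewrite big_ord0.
rewrite big_ord_recr /= IHn ffactnSr natrM; case: (leqP n k) => [le|lt].
  by rewrite natrB.
by rewrite ffact_small // !mul0r.
Qed.

(** The bound matters: at [a = m + n + 1] the polynomial takes the value [(-1)^n], while the
    truncated binomial is 0 for positive [n]. As [ades] can reach [n.+1], only positive [m] are used
    later. *)
Lemma binp_nat (n m a : nat) : (a <= m + n)%N ->
  (binp ('X + n%:R - a%:R) n).[m%:R] = 'C(m + n - a, n)%:R.
Proof.
move=> le_a; rewrite /binp hornerZ horner_prod.
have -> : \prod_(i < n) ('X + n%:R - a%:R - i%:R).[m%:R]
          = ((m + n - a) ^_ n)%:R :> rat.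
  rewrite -prod_natrB_ffact; apply: eq_bigr => i _.
  by rewrite !hornerE -!polyC_natr !hornerC natrB // natrD.
by rewrite -bin_ffact natrM mulrC mulfK // pnatr_eq0 -lt0n fact_gt0.
Qed.

Lemma poly_eq_posnat (R : idomainType) (p q : {poly R}) :
  [pchar R] =i pred0 -> (forall m : nat, (0 < m)%N -> p.[m%:R] = q.[m%:R]) ->
  p = q.
Proof.
move=> /pcharf0P R0 pq; apply/eqP; rewrite -subr_eq0; apply/negPn/negP => nz.
have := @max_poly_roots _ (p - q) [seq m%:R | m <- iota 1 (size (p - q)).+1] nz.
rewrite size_map size_iota ltnNge leqnSn => h; suff : false by []; apply: h.
  apply/allP=> _ /mapP[m + ->]; rewrite mem_iota rootE !hornerE.
  by move=> /andP[/pq-> _]; rewrite subrr.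
rewrite map_inj_uniq ?iota_uniq //.
suff h : forall i j : nat, (i <= j)%N -> i%:R = j%:R :> R -> i = j.
  by move=> i j /= e; case: (leqP i j) => [|/ltnW] le; [exact: h|exact/esym/h].
move=> i j le_ij e; apply/eqP; rewrite eqn_leq le_ij -subn_eq0 -R0.
by rewrite natrB // e subrr eqxx.
Qed.

(** One variable is freed at a time. Taking [R] to be a polynomial ring lets [q] and [r] be
    indeterminates. *)
Lemma horner_mul_subst (R : idomainType) (f : {rmorphism rat -> R})
    (I : finType) (P Q : I -> {poly rat}) (S : {poly rat}) (q r : R) :
  [pchar R] =i pred0 ->
  (forall k l : nat, (0 < k)%N -> (0 < l)%N ->
     \sum_i (P i).[k%:R] * (Q i).[l%:R] = S.[((k * l).*2 + k)%:R]) ->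
  \sum_i (map_poly f (P i)).[q] * (map_poly f (Q i)).[r]
  = (map_poly f S).[2 * q * r + q].
Proof.
move=> R0 natPQ.
have natE k (T : {poly rat}) : (map_poly f T).[k%:R] = f T.[k%:R].
  by rewrite -horner_map rmorph_nat.
(* For fixed [l] both sides are polynomials in the first argument that agree at all positive
   integers. *)
have natqPQ l : (0 < l)%N -> \sum_i (map_poly f (P i)).[q] * f (Q i).[l%:R]
    = (map_poly f S).[2 * q * l%:R + q].
  move=> l0; pose F := \sum_i map_poly f (P i) * (f (Q i).[l%:R])%:P.
  pose G := map_poly f S \Po ((2 * l%:R + 1)%:P * 'X).
  have : F = G.
    apply: poly_eq_posnat => // k k0; rewrite /F /G horner_sum horner_comp.
    rewrite hornerM hornerC hornerX.
    have -> : (2 * l%:R + 1) * k%:R = ((k * l).*2 + k)%:R :> R.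
      by rewrite natrD -mul2n !natrM; ring.
    rewrite natE -natPQ // rmorph_sum; apply: eq_bigr => i _.
    by rewrite hornerM hornerC natE rmorphM.
  move=> /(congr1 (horner^~ q)); rewrite /F /G horner_sum horner_comp.
  rewrite hornerM hornerC hornerX mulrDl mul1r mulrAC => <-.
  by apply: eq_bigr => i _; rewrite hornerM hornerC.
pose F := \sum_i ((map_poly f (P i)).[q])%:P * map_poly f (Q i).
pose G := map_poly f S \Po ((2 * q)%:P * 'X + q%:P).
have : F = G.
  apply: poly_eq_posnat => // l l0; rewrite /F /G horner_sum horner_comp.
  rewrite hornerD hornerM !hornerC hornerX -natqPQ //.
  by apply: eq_bigr => i _; rewrite hornerM hornerC natE.
move=> /(congr1 (horner^~ r)); rewrite /F /G horner_sum horner_comp.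
rewrite hornerD hornerM !hornerC hornerX => <-.
by apply: eq_bigr => i _; rewrite hornerM hornerC.
Qed.

(** * Substitution and multiplication over the group algebra *)

Section Subst.
Variable A : algType rat.

Definition poly2_in_alg (q : {poly {poly rat}}) : {poly {poly A}} :=
  map_poly (map_poly (in_alg A)) q.
Local Notation E := poly2_in_alg.

(** Evaluation over a noncommutative ring is multiplicative only under a commutation condition,
    which this supplies. *)
Lemma comm_poly2_in_alg q (a : A) : E q * a%:P%:P = a%:P%:P * E q.
Proof.
apply/polyP=> i; rewrite coefMC coefCM coef_map /=; apply/polyP=> j.
by rewrite coefMC coefCM coef_map /= mulr_algl mulr_algr.
Qed.

Lemma subst2_sum (I : finType) (P : I -> {poly rat}) (a : I -> A) q :
  subst2 (\sum_i map_poly (in_alg A) (P i) * (a i)%:P) q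
  = \sum_i E (map_poly (polyC \o polyC) (P i)).[q] * (a i)%:P%:P.
Proof.
rewrite /subst2 rmorph_sum /= horner_sum; apply: eq_bigr => i _.
rewrite rmorphM /= [X in _ * X]map_polyC /= hornerM_comm; last first.
  by rewrite /comm_poly hornerC comm_poly2_in_alg.
rewrite hornerC; congr (_ * _); rewrite -[E _ in RHS]/(E _).
rewrite /poly2_in_alg -horner_map; congr (_.[_]); rewrite -!map_poly_comp.
by apply: eq_map_poly => c /=; rewrite map_polyC /= map_polyC.
Qed.

Lemma poly2_in_alg_mul (p q : {poly {poly rat}}) (a b : A) :
  (E p * a%:P%:P) * (E q * b%:P%:P) = E (p * q) * (a * b)%:P%:P.
Proof.
have -> : E (p * q) = E p * E q by rewrite /poly2_in_alg rmorphM.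
by rewrite !polyCM !mulrA; congr (_ * _); rewrite -!mulrA comm_poly2_in_alg.
Qed.

End Subst.

Lemma sum_binp_ades_des (n : nat) (g : hyperoct n)
    (R : idomainType) (f : {rmorphism rat -> R}) (q r : R) :
  [pchar R] =i pred0 ->
  \sum_(s : hyperoct n)
    (map_poly f (binp ('X + n%:R - (ades s)%:R) n)).[q]
    * (map_poly f (binp ('X + n%:R - (des (s^-1 * g)%g)%:R) n)).[r]
  = (map_poly f (binp ('X + n%:R - (ades g)%:R) n)).[2 * q * r + q].
Proof.
move=> R0; apply: horner_mul_subst => // k l k0 l0.
have kl0 : (0 < (k * l).*2 + k)%N by rewrite addn_gt0 k0 orbT.
have adesn m (s : hyperoct n) : (0 < m)%N -> (ades s <= m + n)%N.
  by move=> m0; have := ades_le s; lia.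
rewrite binp_nat ?adesn // -num_sorts_ades // -(num_sorts_mul l k0 g) natr_sum.
apply: eq_bigr => s _; rewrite natrM num_sorts_ades // num_sorts_des //.
by rewrite !binp_nat ?adesn // (leq_trans (des_le _)) ?leq_addl.
Qed.

Lemma subst2_psi (n : nat) (q : {poly {poly rat}}) :
  subst2 (psi n) q = \sum_(s : hyperoct n) poly2_in_alg 'QB_n
    (map_poly (polyC \o polyC) (binp ('X + n%:R - (ades s)%:R) n)).[q]
    * (gdelta rat s)%:P%:P.
Proof. exact: subst2_sum. Qed.

Lemma subst2_phi (n : nat) (q : {poly {poly rat}}) :
  subst2 (phi n) q = \sum_(s : hyperoct n) poly2_in_alg 'QB_n
    (map_poly (polyC \o polyC) (binp ('X + n%:R - (des s)%:R) n)).[q]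
    * (gdelta rat s)%:P%:P.
Proof. exact: subst2_sum. Qed.

(** The pairs of group elements with product [g] are those of the form [s], [s^-1 * g]. *)
Lemma poly2_group_algebra_mul (gT : finGroupType)
    (P Q : gT -> {poly {poly rat}}) (A := galg rat gT) :
  (\sum_s poly2_in_alg A (P s) * (gdelta rat s : A)%:P%:P)
  * (\sum_s poly2_in_alg A (Q s) * (gdelta rat s : A)%:P%:P)
  = \sum_g poly2_in_alg A (\sum_s P s * Q (s^-1 * g)%g)
            * (gdelta rat g : A)%:P%:P.
Proof.
rewrite mulr_suml.
transitivity (\sum_s \sum_g poly2_in_alg A (P s * Q (s^-1 * g)%g)
                    * (gdelta rat g : A)%:P%:P).
  apply: eq_bigr => s _; rewrite mulr_sumr (reindex_inj (mulgI s^-1%g)) /=.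
  by apply: eq_bigr => g _; rewrite poly2_in_alg_mul -gdeltaM mulKVg.
rewrite exchange_big; apply: eq_bigr => g _ /=.
rewrite -mulr_suml; congr (_ * _).
by rewrite /poly2_in_alg rmorph_sum.
Qed.

Lemma subst2_psi_phi (n : nat) (q r : {poly {poly rat}}) :
  subst2 (psi n) q * subst2 (phi n) r = subst2 (psi n) (2 * q * r + q).
Proof.
apply: etrans (esym (subst2_psi _ _)).
apply: (etrans (congr2 *%R (subst2_psi n q) (subst2_phi n r))).
rewrite poly2_group_algebra_mul.
apply: eq_bigr => g _; rewrite sum_binp_ades_des // => p.
by rewrite !pchar_poly pchar_num.
Qed.

Theorem theorem1p5 (n : nat) (n_gt0 : (0 < n)%N) :
  let x : {poly {poly rat}} := 'X in
  let y : {poly {poly rat}} := 'Y in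
  subst2 (psi n) x * subst2 (phi n) y = subst2 (psi n) (2 * x * y + x)
  /\ subst2 (psi n) (x / 2) * subst2 (phi n) ((y - 1) / 2)
     = subst2 (psi n) (x * y / 2).
Proof.
move=> x y; split; first exact: subst2_psi_phi.
have half2 : 2 * 2^-1 = 1 :> {poly {poly rat}} by rewrite mulrV ?unit2_poly2.
apply: etrans (subst2_psi_phi _ _ _) _; congr subst2.
(* Isolating [2 * 2^-1] leaves identities valid with any ring element in place of [2^-1]. *)
transitivity ((2 * 2^-1) * (x * (y - 1) / 2) + x / 2); first by ring.
by rewrite half2; ring.
Qed.
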